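(* Let $\mathbf{X}_1,\dots,\mathbf{X}_n\in\mathbb{R}^d$ and suppose the loss $\rho$ satisfies: (A1) $\rho$ is non-decreasing, $\rho(0)=0$, and $\rho(x)/x\to 0$ as $x\to 0$; (A2) $\varphi(0)\triangleq\lim_{x\to 0}\psi(x)/x$ exists and is finite. Let $\widehat{f}_{RKDE}\in\mathcal{H}$ be a minimizer over $g\in\mathcal{H}$ of $J(g)=\frac1n\sum_{i=1}^n\rho(\|\Phi(\mathbf{X}_i)-g\|_{\mathcal{H}})$. Then for all $\mathbf{x}\in\mathbb{R}^d$, $$\widehat{f}_{RKDE}(\mathbf{x})=\sum_{i=1}^n w_i\,k_\sigma(\mathbf{x},\mathbf{X}_i),$$ where $w_i\ge 0$ for all $i$ and $\sum_{i=1}^n w_i=1$. Furthermore, $$w_i\propto\varphi\bigl(\|\Phi(\mathbf{X}_i)-\widehat{f}_{RKDE}\|_{\mathcal{H}}\bigr),$$ i.e. the weights $w_i$ are proportional to these quantities with a proportionality constant not depending on $i$.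
   Context: The kernel $k_\sigma:\mathbb{R}^d\times\mathbb{R}^d\to[0,\infty)$ satisfies $\int k_\sigma(\mathbf{x},\cdot)\,d\mathbf{x}=1$, is radial, meaning $k_\sigma(\mathbf{x},\mathbf{x}')=g_0(\|\mathbf{x}-\mathbf{x}'\|^2)$ for some function $g_0$, and is positive semi-definite. $\mathcal{H}$ is the reproducing kernel Hilbert space (real) associated with $k_\sigma$, and $\Phi(\mathbf{x})\triangleq k_\sigma(\cdot,\mathbf{x})\in\mathcal{H}$ is the canonical feature map, so $g(\mathbf{x})=\langle\Phi(\mathbf{x}),g\rangle_{\mathcal{H}}$ for $g\in\mathcal{H}$. The loss $\rho:[0,\infty)\to\mathbb{R}$ is differentiable, $\psi\triangleq\rho'$, and $\varphi(x)\triangleq\psi(x)/x$ for $x>0$. The robust kernel density estimate is $\widehat{f}_{RKDE}=\arg\min_{g\in\mathcal{H}}J(g)$.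
   Formalization: The formal theorem additionally assumes that φ(‖Φ(X_i) − f_RKDE‖) is nonzero for at least one i; without this the statement is false (e.g. ρ = 0, where every g in H is a minimizer). *)

(* Defs.v *)
From HB Require Import structures.
From mathcomp Require Export all_boot all_order all_algebra.
From mathcomp Require Export all_classical all_reals all_analysis.
Export Order.TTheory GRing.Theory Num.Theory.
Export numFieldNormedType.Exports.

Set Implicit Arguments.
Unset Strict Implicit.
Unset Printing Implicit Defensive.

Local Open Scope classical_set_scope.
Local Open Scope ring_scope.

(* Points of R^d are d.-tuples: these carry the product (Borel) sigma-algebra,
   whereas 'rV[R]_d is not a measurable type and is normed by the sup norm.
   sqdist is the squared Euclidean distance. *)
Definition sqdist (R : realType) (d : nat) (x y : d.-tuple R) : R :=
  \sum_(i < d) (tnth x i - tnth y i) ^+ 2.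

Section lebesgue_tuple.
Variable R : realType.

Definition tcons (d : nat) (z : R * d.-tuple R) : d.+1.-tuple R :=
  [tuple of z.1 :: z.2].

Lemma measurable_tcons (d : nat) :
  measurable_fun [set: R * d.-tuple R] (@tcons d).
Proof.
by apply: measurable_cons; [exact: measurable_fst|exact: measurable_snd].
Qed.

Section step.
Variables (d : nat) (mu : {sigma_finite_measure set (d.-tuple R) -> \bar R}).

Definition lebesgue_tcons : set (d.+1.-tuple R) -> \bar R :=
  pushforward (lebesgue_measure \x mu)%E (@tcons d).

Let tcons0 : lebesgue_tcons set0 = 0%E.
Proof. by rewrite /lebesgue_tcons /pushforward preimage_set0 measure0. Qed.

Let tcons_ge0 A : (0 <= lebesgue_tcons A)%E.
Proof. by rewrite /lebesgue_tcons /pushforward; exact: measure_ge0. Qed.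

Let tcons_sigma_additive : semi_sigma_additive lebesgue_tcons.
Proof.
move=> F mF tF mUF; rewrite /lebesgue_tcons /pushforward preimage_bigcup.
have mFn n : measurable (@tcons d @^-1` F n).
  by rewrite -[X in measurable X]setTI; exact: measurable_tcons.
apply: measure_semi_sigma_additive => //.
- apply/trivIsetP => /= i j _ _ ij; rewrite -preimage_setI.
  by move/trivIsetP : tF => /(_ _ _ _ _ ij) ->//; rewrite preimage_set0.
- by apply: bigcup_measurable => n _; exact: mFn.
Qed.

HB.instance Definition _ := isMeasure.Build _ _ _ lebesgue_tcons
  tcons0 tcons_ge0 tcons_sigma_additive.

Let tcons_sigma_finite : sigma_finite setT lebesgue_tcons.
Proof.
have /sigma_finiteP[F [TF ndF Foo]] := sigma_finiteT (@lebesgue_measure R).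
have /sigma_finiteP[G [TG ndG Goo]] := sigma_finiteT mu.
pose hd (t : d.+1.-tuple R) := thead t.
pose tl (t : d.+1.-tuple R) : d.-tuple R := [tuple of behead t].
exists (fun n => hd @^-1` F n `&` tl @^-1` G n).
  rewrite predeqE => t; split=> // _.
  have [n _ Fn] : (\bigcup_i F i) (hd t) by rewrite -TF.
  have [m _ Gm] : (\bigcup_i G i) (tl t) by rewrite -TG.
  exists (maxn n m) => //; split.
    by have /subsetPset := ndF _ _ (leq_maxl n m); apply.
  by have /subsetPset := ndG _ _ (leq_maxr n m); apply.
move=> n; have [mF Fn] := Foo n; have [mG Gn] := Goo n; split.
  apply: measurableI; rewrite -[X in measurable X]setTI.
    by apply: (measurable_tnth ord0).
  exact: measurable_behead.
rewrite /lebesgue_tcons /pushforward.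
rewrite (_ : @tcons d @^-1` _ = (F n : set R) `*` G n).
  by rewrite product_measure1E// lte_mul_pinfty// ge0_fin_numE.
rewrite predeqE => -[a t]; have tlK : tl (tcons (a, t)) = t by apply/val_inj.
by split=> -[] /= Fa Gt; split; rewrite /= ?tlK // in Gt *.
Qed.

HB.instance Definition _ := Measure_isSigmaFinite.Build _ _ _ lebesgue_tcons
  tcons_sigma_finite.

End step.

(* d-dimensional Lebesgue measure, as the d-fold product of lebesgue_measure
   transported along R * R^d -> R^d.+1. *)
Fixpoint lebesgue_tuple (d : nat) :
    {sigma_finite_measure set (d.-tuple R) -> \bar R} :=
  if d is d'.+1 then [the {sigma_finite_measure set _ -> \bar R}
                      of lebesgue_tcons (lebesgue_tuple d')]
  else [the {sigma_finite_measure set _ -> \bar R} of \d_ [tuple] ].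

End lebesgue_tuple.

Definition radial (R : realType) (d : nat)
    (k : d.-tuple R -> d.-tuple R -> R) : Prop :=
  exists g0 : R -> R, forall x y, k x y = g0 (sqdist x y).

Definition pos_semidef (R : realType) (T : Type) (k : T -> T -> R) : Prop :=
  forall (m : nat) (x : 'I_m -> T) (c : 'I_m -> R),
    0 <= \sum_(i < m) \sum_(j < m) c i * c j * k (x i) (x j).

(* A real Hilbert space whose elements are functions T -> R through the
   injective map rkhs_fun; linearity of rkhs_fun follows from rkhs_repr. *)
Record rkhs (R : realType) (T : Type) (k : T -> T -> R) := Rkhs {
  rkhs_sort :> completeNormedModType R ;
  rkhs_dot : {dot rkhs_sort for idfun} ;
  rkhs_norm : forall g : rkhs_sort, `|g| ^+ 2 = rkhs_dot g g ;
  rkhs_fun : rkhs_sort -> T -> R ;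
  rkhs_fun_inj : injective rkhs_fun ;
  rkhs_feature : T -> rkhs_sort ;
  rkhs_featureE : forall x : T, rkhs_fun (rkhs_feature x) = k^~ x ;
  rkhs_repr : forall (x : T) (g : rkhs_sort),
    rkhs_fun g x = rkhs_dot (rkhs_feature x) g }.

(* A loss on [0, +oo[ is a function on R whose values on negative arguments
   are never used: the derivative at 0 is one-sided. *)
Definition differentiable_ge0 (R : realType) (rho : R -> R) : Prop :=
  (forall x, 0 < x -> derivable rho x 1) /\
  cvg ((rho h - rho 0) / h @[h --> 0^'+]).

(* The weight function, extended to 0 by continuity. *)
Definition phi (R : realType) (rho : R -> R) (x : R) : R :=
  if 0 < x then derive1 rho x / x else lim (derive1 rho t / t @[t --> 0^'+]).

Definition rkde_risk (R : realType) (T : Type) (k : T -> T -> R) (H : rkhs k)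
    (rho : R -> R) (n : nat) (X : 'I_n -> T) (g : H) : R :=
  n%:R^-1 * \sum_(i < n) rho `|rkhs_feature H (X i) - g|.

(* Main.v *)
(* At a minimizer [f] the one-sided directional derivative of the risk along
   [v = \sum_i phi |Phi(X_i) - f| (Phi(X_i) - f)] is nonnegative.  Each summand
   [rho |Phi(X_i) - f - t v|] has right derivative
   [- phi |Phi(X_i) - f| <Phi(X_i) - f, v>] at [t = 0]: by the chain rule when
   [Phi(X_i) <> f], and because [rho x / x --> 0] otherwise.  Hence
   [- |v|^2 >= 0], so [v = 0]; solving for [f] gives the weights. *)
Require Import Defs.
From mathcomp Require Import ring.

Set Implicit Arguments.
Unset Strict Implicit.
Unset Printing Implicit Defensive.

Local Open Scope classical_set_scope.
Local Open Scope ring_scope.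

(** The two-sided derivative is also the limit of right difference quotients, so comparison with
    points above [x] suffices; this suits a loss that is monotone only on the nonnegative reals. *)
Lemma nondecreasing_right_derive1_ge0 (R : realType) (f : R -> R) (x : R) :
  derivable f x 1 -> (forall y, x <= y -> f x <= f y) -> 0 <= derive1 f x.
Proof.
move=> df fmono; rewrite derive1E.
apply: (cvgr_to_ge (cvg_dnbhs_at_right df)); near=> h.
have h0 : 0 < h by near: h; exact: nbhs_right_gt.
rewrite /= [h *: 1]mulr1; apply: mulr_ge0; first by rewrite invr_ge0 ltW.
by rewrite subr_ge0 fmono// lerDr ltW.
Unshelve. all: by end_near. Qed.

Lemma phi_ge0 (R : realType) (rho : R -> R) (x : R) :
  differentiable_ge0 rho ->
  (forall x y, 0 <= x -> x <= y -> rho x <= rho y) ->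
  cvg (derive1 rho t / t @[t --> 0^'+]) ->
  0 <= phi rho x.
Proof.
move=> [drho _] rho_mono phi0_cvg.
have pos t : 0 < t -> 0 <= derive1 rho t / t.
  move=> t0; apply: divr_ge0; last exact: ltW.
  apply: nondecreasing_right_derive1_ge0.
    exact: drho.
  by move=> y; apply: rho_mono; exact: ltW.
(* Otherwise [phi] is the limit at [0^'+], which inherits the sign of the quotients. *)
rewrite /phi; case: ifPn => [/pos//|_].
apply: limr_ge => //; near=> t; apply: pos.
by near: t; exact: nbhs_right_gt.
Unshelve. all: by end_near. Qed.

Section rkhs_theory.
Context {R : realType} {T : Type} {k : T -> T -> R} {H : rkhs k}.
Local Notation dot := (rkhs_dot H).
Implicit Types (a v : H) (rho : R -> R).

(** Expands the squared norm as a quadratic in [t], with [t] factored out so that the product rule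
    at 0 leaves only [- 2 * dot a v]. *)
Lemma rkhs_norm_subZ a v (t : R) :
  `|a - t *: v| = Num.sqrt (`|a| ^+ 2 + t * (t * `|v| ^+ 2 - 2 * dot a v)).
Proof.
rewrite -[LHS]ger0_norm// -sqrtr_sqr; congr Num.sqrt.
rewrite !rkhs_norm hnormB linearZl_LR !(linearZr_LR (rkhs_dot H))/=.
rewrite expr0 mul1r; ring.
Qed.

(** Since [a != 0], the square root is taken near [|a| ^+ 2 > 0], where it is differentiable. *)
Lemma is_derive_norm_subZ a v : a != 0 ->
  is_derive (0 : R) 1 (fun t : R => `|a - t *: v|) (- (dot a v / `|a|)).
Proof.
move=> a0.
have -> : (fun t : R => `|a - t *: v|) =
  Num.sqrt \o (cst (`|a| ^+ 2) + id * ((`|v| ^+ 2) \*: id - cst (2 * dot a v))).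
  apply/funext => t; rewrite rkhs_norm_subZ /= !fctE/=; congr Num.sqrt.
  by rewrite /cst/= [t * `|v| ^+ 2]mulrC.
set p := (X in _ \o X).
have p0 : p 0 = `|a| ^+ 2 by rewrite /p !fctE/= mul0r addr0.
have dp : is_derive (0 : R) 1 p (- (2 * dot a v)).
  apply: is_derive_eq; rewrite !fctE/= scale0r.
  by rewrite scaler0 sub0r !add0r; exact: mulr1.
have ds : is_derive (p 0) 1 Num.sqrt (2 * `|a|)^-1.
  rewrite p0 -{2}(ger0_norm (normr_ge0 a)) -sqrtr_sqr.
  by apply: is_derive1_sqrt; rewrite exprn_gt0// normr_gt0.
apply: is_derive_eq.
by rewrite mulrN invfM mulrACA mulVf ?pnatr_eq0// mul1r mulrC.
Qed.

Lemma rkhs_loss_right_derivative rho a v :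
  differentiable_ge0 rho -> rho 0 = 0 ->
  rho x / x @[x --> 0^'+] --> 0 ->
  (rho `|a - t *: v| - rho `|a|) / t @[t --> 0^'+]
    --> - (phi rho `|a| * dot a v).
Proof.
move=> [drho _] rho0 rho_small.
have [->|a0] := eqVneq a 0.
  rewrite normr0 rho0 linear0l mulr0 oppr0.
  (* For [v != 0], substitute [s = |v| * t], which tends to 0 from the right: [rho (|v| * t) / t]
     equals [|v| * (rho s / s)], which tends to 0. *)
  have [->|v0] := eqVneq v 0.
    apply: cvg_near_cst; near=> t.
    by rewrite scaler0 subrr normr0 rho0 addr0 mul0r.
  have v_gt0 : 0 < `|v| by rewrite normr_gt0.
  have sv : `|v| * t @[t --> 0^'+] --> 0^'+.
    move=> P vP; have {}vP : \forall s \near `|v| * 0, 0 < s -> P s.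
      by rewrite mulr0.
    have {}vP : \forall t \near (0 : R), 0 < `|v| * t -> P (`|v| * t).
      exact: (@mulrl_continuous R `|v| 0 _ vP).
    near_simpl; rewrite near_withinE; near_simpl; near=> t => t0.
    by apply: (near vP t) => //; rewrite mulr_gt0.
  have := cvgMl_tmp (a := `|v|) (cvg_comp _ _ sv rho_small).
  rewrite mulr0 => /(_ _); apply: cvg_trans.
  apply: near_eq_cvg; near=> t.
  have t0 : 0 < t by near: t; exact: nbhs_right_gt.
  rewrite /= sub0r normrN normrZ (gtr0_norm t0) addr0 (mulrC t).
  by rewrite invfM mulrCA mulVKf ?gt_eqF.
have a_gt0 : 0 < `|a| by rewrite normr_gt0.
have dn := is_derive_norm_subZ v a0.
have a0E : `|a - 0 *: v| = `|a| by rewrite scale0r subr0.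
(* The base point is kept as the value at 0 of the inner function, the form that the chain rule
   expects. *)
have dr : is_derive `|a - (0 : R) *: v| 1 rho (derive1 rho `|a|).
  rewrite a0E; apply: DeriveDef; first exact: drho.
  by rewrite derive1E.
have [dd de] := is_derive1_comp dr dn.
rewrite /phi a_gt0 mulrAC -mulrA -mulrN -de.
have := cvg_dnbhs_at_right dd.
apply: cvg_trans; apply: near_eq_cvg; near=> h.
by rewrite /= a0E addr0 [h *: 1]mulr1 [RHS]mulrC.
Unshelve. all: by end_near. Qed.

Lemma rkde_score_eq0 rho n (X : 'I_n -> T) (f : H) :
  differentiable_ge0 rho -> rho 0 = 0 -> rho x / x @[x --> 0^'+] --> 0 ->
  (0 < n)%N ->
  (forall g : H, rkde_risk rho X f <= rkde_risk rho X g) ->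
  \sum_(i < n) phi rho `|rkhs_feature H (X i) - f| *: (rkhs_feature H (X i) - f)
    = 0.
Proof.
move=> drho rho0 rho_small n_gt0 f_min.
set a := fun i => rkhs_feature H (X i) - f.
set v := \sum_(i < n) _.
have cvgJ : \sum_(i < n) (rho `|a i - t *: v| - rho `|a i|) / t @[t --> 0^'+]
    --> \sum_(i < n) - (phi rho `|a i| * dot (a i) v).
  apply: cvg_big => [|i _]; first exact: add_continuous.
  exact: rkhs_loss_right_derivative.
have := cvgr_to_ge cvgJ.
(* The weighted sum of the [a i] is [v] itself, so linearity turns the sum into [dot v v]. *)
have -> : \sum_(i < n) - (phi rho `|a i| * dot (a i) v) = - `|v| ^+ 2.
  rewrite sumrN rkhs_norm {3}/v linear_sumlz; congr (- _).
  by apply: eq_bigr => i _; rewrite linearZl_LR.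
move=> /(_ _ 0) H0; apply/eqP; rewrite -normr_eq0 -sqrf_eq0 eq_le sqr_ge0 andbT.
rewrite -oppr_ge0; apply: H0; near=> t.
have t0 : 0 < t by near: t; exact: nbhs_right_gt.
(* As [a i - t *: v] is [Phi(X_i) - (f + t *: v)], the numerator is [n] times the increase of the
   risk from [f] to [f + t *: v]. *)
rewrite -mulr_suml; apply: divr_ge0; last exact: ltW.
have := f_min (f + t *: v).
rewrite /rkde_risk ler_pM2l ?invr_gt0 ?ltr0n// sumrB subr_ge0.
move=> /le_trans; apply; rewrite le_eqVlt; apply/orP; left; apply/eqP.
by apply: eq_bigr => i _; rewrite opprD addrA.
Unshelve. all: by end_near. Qed.

End rkhs_theory.

Theorem theorem1 (R : realType) (d n : nat)
  (k : d.-tuple R -> d.-tuple R -> R)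
  (k_ge0 : forall x y, 0 <= k x y)
  (k_meas : forall x, measurable_fun setT (k x))
  (k_int : forall x, (\int[lebesgue_tuple R d]_y (k x y)%:E = 1)%E)
  (k_radial : radial k)
  (k_psd : pos_semidef k)
  (H : rkhs k)
  (rho : R -> R)
  (rho_diff : differentiable_ge0 rho)
  (rho_mono : forall x y, 0 <= x -> x <= y -> rho x <= rho y)
  (rho0 : rho 0 = 0)
  (rho_small : rho x / x @[x --> 0^'+] --> 0)
  (phi0_cvg : cvg (derive1 rho x / x @[x --> 0^'+]))
  (n_gt0 : (0 < n)%N)
  (X : 'I_n -> d.-tuple R)
  (f : H)
  (f_min : forall g : H, rkde_risk rho X f <= rkde_risk rho X g)
  (f_nondeg : exists i, phi rho `|rkhs_feature H (X i) - f| != 0) :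
  exists w : 'I_n -> R,
    [/\ forall x, rkhs_fun f x = \sum_(i < n) w i * k x (X i),
        forall i, 0 <= w i,
        \sum_(i < n) w i = 1
      & exists c : R, forall i,
          w i = c * phi rho `|rkhs_feature H (X i) - f| ].
Proof.
have := rkde_score_eq0 rho_diff rho0 rho_small n_gt0 f_min.
set p := fun i => phi rho `|rkhs_feature H (X i) - f| => score0.
have p_ge0 i : 0 <= p i by exact: phi_ge0.
set S := \sum_(i < n) p i.
(* A vanishing sum of nonnegative terms would force every [p i] to be 0, against [f_nondeg]. *)
have S_neq0 : S != 0.
  case: f_nondeg => i pi_neq0; apply/eqP => /psumr_eq0P S0.
  by rewrite [phi _ _]S0 ?eqxx in pi_neq0.
(* The score equation reads [\sum_i p i *: Phi(X_i) = S *: f]; divide by [S]. *)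
have fE : f = \sum_(i < n) (S^-1 * p i) *: rkhs_feature H (X i).
  move: score0; under eq_bigr do rewrite scalerBr.
  rewrite sumrB -scaler_suml => /subr0_eq /esym fE.
  rewrite -[LHS](scalerK S_neq0) [S *: f]fE scaler_sumr.
  by apply: eq_bigr => i _; rewrite scalerA.
exists (fun i => S^-1 * p i); split.
- move=> x; rewrite rkhs_repr {1}fE linear_sumr; apply: eq_bigr => i _.
  by rewrite linearZr_LR/= -rkhs_repr rkhs_featureE.
- by move=> i; rewrite mulr_ge0// invr_ge0 sumr_ge0.
- by rewrite -mulr_sumr mulVf.
- by exists S^-1.
Qed.
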